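(* Let $\Gamma=(X,R)$ be a bipartite distance-regular graph with even diameter $D\ge4$ and valency $k\ge3$, let $d=D/2$, fix $x\in X$, let $W$ be a thin irreducible $T(x)$-module with endpoint $2$ and local eigenvalue $\tilde\theta_d$, and let $v$ be a nonzero vector in $E^*_2W$. Then $$E^*_{i+2}A_iv=\sum_{\substack{h=0\\ i-h\ \text{even}}}^{i}\frac{P_h(0)}{P_i(0)}\,\frac{k_ib_ib_{i+1}}{k_hb_hb_{h+1}}\,p_h(A)v\qquad(0\le i\le D-2),$$ and both sides of this equation are zero for $i=D-2$.
   Context: $\Gamma$ is a finite connected bipartite distance-regular graph with distance $\partial$, intersection numbers $c_i,b_i$ ($c_0=0$, $b_D=0$), and $k_i=b_0b_1\cdots b_{i-1}/(c_1c_2\cdots c_i)$ (the number of vertices at distance $i$ from a given vertex). $A_i$ are the distance matrices, $A=A_1$; $\theta_0>\dots>\theta_D$ eigenvalues of $A$. $E^*_i$ is the diagonal matrix with $(y,y)$-entry $1$ if $\partial(x,y)=i$ and $0$ otherwise; $T(x)$ is generated by $A,E^*_0,\dots,E^*_D$; $T$-modules are $T$-invariant subspaces of $V=\mathbb{C}^X$; irreducible, thin ($\dim E^*_iW\le1$ for all $i$), endpoint ($\min\{i:E^*_iW\neq0\}$) as usual; the local eigenvalue of a thin irreducible module $W$ with endpoint 2 is the eigenvalue of $E^*_2A_2E^*_2$ on the one-dimensional space $E^*_2W$. $\tilde\theta_d=-1-b_2b_3(\theta_d^2-b_2)^{-1}$. Polynomials: $f_0=1$, $f_{-1}=0$, $\lambda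 f_i=b_{i-1}f_{i-1}+c_{i+1}f_{i+1}$ $(0\le i\le D-1)$; $p_i=f_i+f_{i-2}+f_{i-4}+\cdots$ (ending with $f_0$ if $i$ is even, $f_1$ if $i$ is odd). Each $p_i$ is an even (resp. odd) polynomial when $i$ is even (resp. odd), and $P_i\in\mathbb{R}[\lambda]$ is defined by $p_i(\lambda)=P_i(\lambda^2)$ if $i$ is even and $p_i(\lambda)=\lambda P_i(\lambda^2)$ if $i$ is odd. (For even $D$, $P_i(0)\ne0$ for $0\le i\le D-1$.) *)

(* Defs.v *)
From mathcomp Require Import all_boot all_order all_algebra.
From mathcomp Require Import complex.
From mathcomp Require Import reals.

Set Implicit Arguments.
Unset Strict Implicit.
Unset Printing Implicit Defensive.

Import Order.TTheory GRing.Theory Num.Theory.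
Local Open Scope ring_scope.
Local Open Scope complex_scope.

Section Graph.
Variables (X : finType) (e : rel X).

Definition simple_graph := symmetric e /\ irreflexive e.

Definition connected := forall y z : X, connect e y z.

Definition bipartite :=
  exists S : {set X}, forall y z, e y z -> (y \in S) != (z \in S).

Definition regular_of_valency (k : nat) :=
  forall y : X, #|[set z | e y z]| = k.

Definition walk (n : nat) (y z : X) : bool :=
  [exists p : n.-tuple X, path e y p && (last y p == z)].

(* Least length of a walk from y to z; a shortest walk has length < #|X|, and
   the value is #|X| when y and z are not connected. *)
Definition dist (y z : X) : nat := find (fun n => walk n y z) (iota 0 #|X|).

Definition diameter : nat := \max_(y : X) \max_(z : X) dist y z.

(* e is distance-regular with intersection numbers c_i, b_i, i.e. for y, z at
   distance i, c i (resp. b i) neighbours of z are at distance i - 1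
   (resp. i + 1) from y.  On a nonempty connected graph this forces c 0 = 0
   and b D = 0, and leaves c and b unconstrained above the diameter D. *)
Definition distance_regular (c b : nat -> nat) :=
  forall y z : X,
       #|[set w | e z w & (dist y w).+1 == dist y z]| = c (dist y z)
    /\ #|[set w | e z w & dist y w == (dist y z).+1]| = b (dist y z).

End Graph.

(* The matrices act on column vectors; rows and columns are indexed by X
   through enum_val : 'I_#|X| -> X. *)
Section Algebra.
Variables (R : realType) (X : finType) (e : rel X) (x : X).
Local Notation C := (R[i]).
Local Notation M := 'M[C]_#|X|.
Local Notation V := 'cV[C]_#|X|.

Definition distmx (i : nat) : M :=
  \matrix_(y, z) (dist e (enum_val y) (enum_val z) == i)%:R.

Definition adjmx : M := distmx 1.

Definition Estar (i : nat) : M :=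
  \matrix_(y, z) ((y == z) && (dist e x (enum_val y) == i))%:R.

Inductive Talg : M -> Prop :=
| Talg_adj : Talg adjmx
| Talg_Estar i of (i <= diameter e)%N : Talg (Estar i)
| Talg_one : Talg 1%:M
| Talg_add B1 B2 of Talg B1 & Talg B2 : Talg (B1 + B2)
| Talg_scale (a : C) B of Talg B : Talg (a *: B)
| Talg_mul B1 B2 of Talg B1 & Talg B2 : Talg (B1 *m B2).

Definition Tmodule (W : {vspace V}) :=
  forall B w, Talg B -> w \in W -> B *m w \in W.

Definition irreducible_Tmodule (W : {vspace V}) :=
  [/\ Tmodule W, W != 0%VS &
      forall U : {vspace V}, Tmodule U -> (U <= W)%VS -> U = 0%VS \/ U = W].

Definition EstarW (i : nat) (W : {vspace V}) : {vspace V} :=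
  (linfun (mulmx (Estar i) : V -> V) @: W)%VS.

Definition thin (W : {vspace V}) :=
  forall i, (i <= diameter e)%N -> (\dim (EstarW i W) <= 1)%N.

Definition has_endpoint (W : {vspace V}) (r : nat) :=
  EstarW r W != 0%VS /\ forall i, (i < r)%N -> EstarW i W = 0%VS.

(* Meaningful when W is thin with endpoint 2, so that E*_2 W is a line. *)
Definition has_local_eigenvalue (W : {vspace V}) (eta : C) :=
  forall w, w \in EstarW 2 W -> Estar 2 *m distmx 2 *m Estar 2 *m w = eta *: w.

End Algebra.

(* p(B); horner_mx is not applicable because #|X| is not syntactically a
   successor. *)
Definition polymx (R : realType) (n : nat) (p : {poly R}) (B : 'M[R[i]]_n) :
    'M[R[i]]_n :=
  \sum_(j < size p) (p`_j)%:C *: B ^+ j.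

Section Polynomials.
Variables (R : realType) (c b : nat -> nat).

(* c_{i+1} f_{i+1} = 'X f_i - b_{i-1} f_{i-1}, with f_{-1} = 0. *)
Fixpoint fpoly (n : nat) : {poly R} :=
  match n with
  | 0 => 1
  | m.+1 => (c m.+1)%:R^-1 *:
      ('X * fpoly m - (if m is l.+1 then (b l)%:R *: fpoly l else 0))
  end.

Definition ppoly (i : nat) : {poly R} :=
  \sum_(j < i.+1 | ~~ odd (i - j)) fpoly j.

(* ppoly_Ppoly below is the defining property. *)
Definition Ppoly (i : nat) : {poly R} :=
  if odd i then odd_poly (ppoly i) else even_poly (ppoly i).

Definition kk (i : nat) : R :=
  (\prod_(0 <= j < i) (b j)%:R) / (\prod_(1 <= j < i.+1) (c j)%:R).

Lemma fpoly_parity n j : odd j != odd n -> (fpoly n)`_j = 0.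
Proof.
elim/ltn_ind: n j => -[|n] IH j /=.
  by rewrite coef1; case: j.
move=> hj; rewrite coefZ coefB coefXM.
have -> : (if j == 0 then 0 else (fpoly n)`_j.-1) = 0.
  case: j hj => [|j] //= hj; apply: IH => //.
  by move: hj; case: (odd j); case: (odd n).
case: n IH hj => [|n] IH hj; first by rewrite coef0 subrr mulr0.
rewrite coefZ IH ?mulr0 ?subrr ?mulr0 //.
by move: hj => /=; rewrite negbK.
Qed.

Lemma ppoly_parity n j : odd j != odd n -> (ppoly n)`_j = 0.
Proof.
move=> hj; rewrite /ppoly coef_sum big1 // => l hl; apply: fpoly_parity.
have hln : (l <= n)%N by rewrite -ltnS.
by move: hl hj; rewrite oddB //; case: (odd j); case: (odd n); case: (odd l).
Qed.

Lemma ppoly_Ppoly i :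
  ppoly i = if odd i then 'X * (Ppoly i \Po 'X^2) else Ppoly i \Po 'X^2.
Proof.
rewrite -[LHS]poly_even_odd /Ppoly; case hi: (odd i).
  have -> : even_poly (ppoly i) = 0.
    apply/polyP => j.
    by rewrite coef_even_poly coef0 ppoly_parity ?odd_double ?hi.
  by rewrite comp_poly0 add0r mulrC.
have -> : odd_poly (ppoly i) = 0.
  apply/polyP => j.
  by rewrite coef_odd_poly coef0 ppoly_parity //= odd_double hi.
by rewrite comp_poly0 mul0r addr0.
Qed.

End Polynomials.

(* Main.v *)
Require Import Defs.
From mathcomp Require Import all_boot all_order all_algebra.
From mathcomp Require Import complex.
From mathcomp Require Import reals.
From mathcomp Require Import zify ring lra.

Set Implicit Arguments.
Unset Strict Implicit.
Unset Printing Implicit Defensive.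

Import Order.TTheory GRing.Theory Num.Theory.
Local Open Scope ring_scope.
Local Open Scope complex_scope.

(* Write [A_n v] as the sum of its components at distances n - 2, n and n + 2
   from x, and let [up_comp n] and [down_comp n] be the outer two.  Since the
   entries of v sum to 0, the middle component of [A_(n+2) v] is
   [- (up_comp n + down_comp (n+2))], and hence
   [p_n(A) v = up_comp n - down_comp n].  The components of the identities
   [A A_j = b_(j-1) A_(j-1) + c_(j+1) A_(j+1)] on the subconstituents describe the
   action of A on these vectors.  Thinness gives scalars with
   [down_comp (n+2) = gam n *: up_comp n], determined recursively from the local
   eigenvalue.  As [theta_d = 0] (the spectrum is symmetric), this local
   eigenvalue is [b_3 - 1], and the recursion [c_(n+1) P_(n+1)(0) +
   b_(n+1) P_(n-1)(0) = (n even) P_n(0)] solves it: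
   [gam n = kappa n / kappa (n+2)] for [kappa n = P_n(0) / (k_n b_n b_(n+1))].
   So [\sum_h kappa h *: p_h(A) v] telescopes to [kappa i *: up_comp i].
   Finally [P_D(0) = 0] makes A vanish on [up_comp (D-2)], which would therefore
   span a proper submodule of W if it were nonzero. *)

(** * Distances, parity and intersection numbers of a bipartite distance-regular graph *)

Section Distance.
Variables (X : finType) (e : rel X).

Lemma walkP n y z :
  reflect (exists p, [/\ size p = n, path e y p & last y p = z]) (walk e n y z).
Proof.
apply: (iffP existsP) => [[p /andP[ep /eqP lp]]|[p [sp ep lp]]].
  by exists p; rewrite size_tuple.
by exists (tcast sp (in_tuple p)); rewrite val_tcast ep /= lp eqxx.
Qed.

Lemma dist_le n y z : walk e n y z -> (dist e y z <= n)%N.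
Proof.
rewrite leqNgt => wn; apply/negP => lt_n.
have:= before_find 0 lt_n; rewrite nth_iota ?add0n ?wn //.
by apply: leq_trans lt_n _; rewrite -[leqRHS](size_iota 0) find_size.
Qed.

Hypothesis conn_e : connected e.

(** A duplicate-free path has fewer than [#|X|] edges, so connectedness makes the search defining
    [dist] succeed. *)
Lemma dist_walk y z : walk e (dist e y z) y z.
Proof.
have hasw : has (fun n => walk e n y z) (iota 0 #|X|).
  have /connectP[p ep ->] := conn_e y z.
  case/shortenP: ep => p' ep' Up' _; apply/hasP; exists (size p').
    by rewrite mem_iota /= -[(size p').+1]/(size (y :: p')) -(card_uniqP Up') max_card.
  by apply/walkP; exists p'.
have:= nth_find 0 hasw; rewrite -/(dist e y z) nth_iota //.
by rewrite -[ltnRHS](size_iota 0) -has_find.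
Qed.

Lemma dist_refl y : dist e y y = 0.
Proof. by apply/eqP; rewrite -leqn0; apply/dist_le/walkP; exists [::]. Qed.

Lemma dist_eq0 y z : (dist e y z == 0) = (y == z).
Proof.
apply/eqP/eqP => [d0|->]; last exact: dist_refl.
by have /walkP[p [+ _ <-]] := dist_walk y z; rewrite d0 => /size0nil->.
Qed.

Lemma dist_triangle y z w : (dist e y w <= dist e y z + dist e z w)%N.
Proof.
have /walkP[p [<- ep lp]] := dist_walk y z.
have /walkP[q [<- eq lq]] := dist_walk z w.
by apply/dist_le/walkP; exists (p ++ q); rewrite size_cat cat_path last_cat lp ep.
Qed.

Lemma dist_edge_le y z : e y z -> (dist e y z <= 1)%N.
Proof. by move=> yz; apply/dist_le/walkP; exists [:: z]; rewrite /= yz. Qed.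

Lemma dist_pred n y z : dist e y z = n.+1 -> exists2 w, e w z & dist e y w = n.
Proof.
move=> dn; have /walkP[p []] := dist_walk y z; rewrite dn.
case/lastP: p => [//|p w]; rewrite size_rcons rcons_path last_rcons.
move=> [sp] /andP[ep ew] wz; subst w; exists (last y p) => //.
have: (dist e y (last y p) <= n)%N by apply/dist_le/walkP; exists p.
by have := dist_triangle y (last y p) z; have := dist_edge_le ew; lia.
Qed.

Hypothesis graph_e : simple_graph e.

Lemma dist_sym y z : dist e y z = dist e z y.
Proof.
have half u w : (dist e w u <= dist e u w)%N.
  have /walkP[p [<- ep <-]] := dist_walk u w.
  apply/dist_le/walkP; exists (rev (belast u p)).
  rewrite size_rev size_belast rev_path; split=> //.
    by rewrite (eq_path (e' := e)) // => s t; rewrite (proj1 graph_e).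
  by case: p ep => //= s p _; rewrite rev_cons last_rcons.
by apply/eqP; rewrite eqn_leq !half.
Qed.

Lemma dist_triangle_sym x y z : (dist e x y <= dist e x z + dist e y z)%N
  /\ (dist e y z <= dist e x y + dist e x z)%N.
Proof.
split; first by rewrite [dist e y z]dist_sym dist_triangle.
by rewrite [dist e x y]dist_sym dist_triangle.
Qed.

Lemma dist_eq1 y z : (dist e y z == 1) = e y z.
Proof.
apply/eqP/idP => [/dist_pred[w wz /eqP]|yz].
  by rewrite dist_eq0 => /eqP->.
have := dist_edge_le yz; have: dist e y z != 0; last by lia.
by rewrite dist_eq0; apply: contraL yz => /eqP->; rewrite (proj2 graph_e).
Qed.

Hypothesis bip_e : bipartite e.

(** Every edge changes sides, so the parity of any walk, in particular of a shortest one, tells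
    whether its ends lie on the same side. *)
Lemma bipartite_side : exists2 s : pred X,
  (forall y z, e y z -> s z = ~~ s y) &
  forall y z, odd (dist e y z) = (s y (+) s z).
Proof.
have [S bipS] := bip_e; exists (mem S) => /= [y z /bipS|y z].
  by case: (y \in S); case: (z \in S).
have /walkP[p [<- ep <-]] := dist_walk y z.
elim: p y ep => [|w p IH] y /=; first by rewrite addbb.
case/andP=> /bipS yw /IH->.
by case: (y \in S) yw; case: (w \in S); case: (_ \in S).
Qed.

Lemma dist_parity y z w : odd (dist e y w) = odd (dist e y z) (+) odd (dist e z w).
Proof.
have [s _ ds] := bipartite_side.
by rewrite !ds; case: (s y); case: (s z); case: (s w).
Qed.

Lemma dist_parity_sym x y z :
  odd (dist e y z) = odd (dist e x y) (+) odd (dist e x z).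
Proof. by rewrite (dist_parity y x) dist_sym. Qed.

Lemma dist_le_diameter y z : (dist e y z <= diameter e)%N.
Proof.
by apply: leq_trans (leq_bigmax y); apply: (leq_bigmax (F := dist e y)).
Qed.

(** A pair realising the diameter exists because [x] makes [X] nonempty; stepping back along a
    shortest walk then lowers the distance by one at a time. *)
Lemma dist_attained (x : X) i : (i <= diameter e)%N -> exists y z, dist e y z = i.
Proof.
have X_gt0 : (0 < #|X|)%N by apply/card_gt0P; exists x.
have [y Dy] := @bigop.eq_bigmax X (fun y => \max_z dist e y z) X_gt0.
have [z Dz] := @bigop.eq_bigmax X (dist e y) X_gt0.
have: exists z, dist e y z = diameter e by exists z; rewrite /diameter Dy Dz.
move: (diameter e) => D; elim: D => [|D IH] [w dw].
  by rewrite leqn0 => /eqP->; exists y, w.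
rewrite leq_eqVlt => /predU1P[->|/IH]; first by exists y, w.
by apply; have [u _ <-] := dist_pred dw; exists u.
Qed.

Variables (c b : nat -> nat).
Hypothesis dreg_e : distance_regular e c b.

Lemma dist_neighbour y z w : e z w ->
  dist e y w = (dist e y z).+1 \/ (dist e y w).+1 = dist e y z.
Proof.
move=> zw; have := dist_parity y z w.
have := dist_triangle y z w; have := dist_triangle y w z.
rewrite (dist_sym w z); move: zw; rewrite -dist_eq1 => /eqP-> /=.
lia.
Qed.

Lemma c_pos (x : X) i : (0 < i <= diameter e)%N -> (0 < c i)%N.
Proof.
case: i => // i /= /(dist_attained x)[y [z dyz]].
have [+ _] := dreg_e y z; have [w wz dyw] := dist_pred dyz; rewrite dyz => <-.
by rewrite card_gt0; apply/set0Pn; exists w; rewrite inE (proj1 graph_e) wz dyw /=.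
Qed.

Lemma b_pos (x : X) i : (i < diameter e)%N -> (0 < b i)%N.
Proof.
move=> /(dist_attained x)[y [z dyz]].
have [w wz dyw] := dist_pred dyz.
have [_] := dreg_e y w; rewrite dyw => <-.
by rewrite card_gt0; apply/set0Pn; exists z; rewrite inE wz dyz /=.
Qed.

Lemma b_diameter (x : X) : b (diameter e) = 0.
Proof.
have [y [z dyz]] := dist_attained x (leqnn _).
have [_] := dreg_e y z; rewrite dyz => <-; apply/eqP; rewrite cards_eq0.
apply/eqP/setP=> w; rewrite !inE; apply/negP => /andP[_ /eqP dw].
by have := dist_le_diameter y w; rewrite dw ltnn.
Qed.

Lemma c_0 (x : X) : c 0 = 0.
Proof.
have [+ _] := dreg_e x x; rewrite dist_refl => <-; apply/eqP; rewrite cards_eq0.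
by apply/eqP/setP=> w; rewrite !inE /= andbF.
Qed.

Lemma c_1 (x : X) : (0 < diameter e)%N -> c 1 = 1.
Proof.
move=> /(dist_attained x)[y [z dyz]].
have [+ _] := dreg_e y z; rewrite dyz => <-; apply: etrans (cards1 y).
apply: eq_card => w; rewrite !inE eqSS dist_eq0
  [RHS]eq_sym andb_idl // => /eqP<-.
by rewrite -dist_eq1 dist_sym dyz.
Qed.

(** By bipartiteness no neighbour of z is as far from y as z is, so the sets counted by [c i] and
    [b i] partition the neighbourhood of z. *)
Lemma cb_valency (x : X) k i : regular_of_valency e k -> (i <= diameter e)%N ->
  (c i + b i)%N = k.
Proof.
move=> reg_e /(dist_attained x)[y [z dyz]]; have [] := dreg_e y z.
rewrite dyz => <- <-; rewrite -(reg_e z) -cardsUI addnC.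
rewrite (_ : _ :&: _ = set0) ?cards0 ?add0n; last first.
  by apply/setP=> w; rewrite !inE; lia.
apply: eq_card => w; rewrite !inE -andb_orr andb_idr //.
by move=> /(dist_neighbour y); lia.
Qed.

End Distance.

(** The index n + 1 has the wrong parity and drops out. This serves both the definition of [ppoly]
    and the final telescoping sum. *)
Lemma big_same_parity_recr (V : nmodType) (F : nat -> V) n :
  \sum_(j < n.+3 | ~~ odd (n.+2 - j)) F j
  = \sum_(j < n.+1 | ~~ odd (n - j)) F j + F n.+2.
Proof.
rewrite big_mkcond 2!big_ord_recr /= subnn subSnn /= addr0.
congr (_ + _); rewrite [RHS]big_mkcond; apply: eq_bigr => j _.
have jn : (j <= n)%N by rewrite -ltnS.
by rewrite !subSn ?leqW //= negbK.
Qed.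

(** * Recursions for p_n and P_n(0), and the scalars built from them *)

Section PolynomialSequences.
Variables (R : realType) (c b : nat -> nat).
Local Notation f := (fpoly R c b).
Local Notation p := (ppoly R c b).
Local Notation P0 i := (Ppoly R c b i).[0].

Lemma ppoly0 : p 0 = 1.
Proof. by rewrite /ppoly big_mkcond big_ord1. Qed.

Lemma ppoly1 : p 1 = f 1.
Proof. by rewrite /ppoly big_mkcond !big_ord_recr big_ord0 /= !add0r. Qed.

Lemma ppolySS n : p n.+2 = p n + f n.+2.
Proof. exact: big_same_parity_recr. Qed.

Lemma fpoly_rec n : c n.+1 != 0%N ->
  'X * f n = (c n.+1)%:R *: f n.+1 + (if n is m.+1 then (b m)%:R *: f m else 0).
Proof. by move=> cn; rewrite /= scalerA divff ?pnatr_eq0 // scale1r subrK. Qed.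

(** The boolean [odd n] is read as the index 0 or 1: P_n(0) is the constant coefficient of p_n for
    even n and the linear one for odd n. *)
Lemma Ppoly_at0 n : P0 n = (p n)`_(odd n).
Proof.
rewrite horner_coef0 /Ppoly; case: (odd n).
  by rewrite coef_odd_poly.
by rewrite coef_even_poly.
Qed.

Variables (D k : nat).
Hypotheses (c_gt0 : forall i, (0 < i <= D)%N -> (0 < c i)%N)
  (c0 : c 0 = 0%N) (c1 : c 1 = 1%N).
Hypothesis cb : forall i, (i <= D)%N -> (c i + b i)%N = k.

(** Induction in steps of two. Adding the recurrence for f_(n+2) to that for p_n gives (c_(n+1) +
    b_(n+1)) p_(n+1) + c_(n+3) f_(n+3), and c_i + b_i = k turns the first factor into c_(n+3) +
    b_(n+3). *)
Lemma ppoly_rec n : (n < D)%N ->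
  'X * p n = (c n.+1)%:R *: p n.+1 + (if n is m.+1 then (b n.+1)%:R *: p m else 0).
Proof.
have cbR i : (i <= D)%N -> (c i)%:R + (b i)%:R = k%:R :> R.
  by move=> /cb<-; rewrite natrD.
have c_neq0 i : (i < D)%N -> c i.+1 != 0%N by move=> iD; rewrite -lt0n c_gt0.
elim/ltn_ind: n => -[|[|n]] IH nD.
- by rewrite ppoly0 ppoly1 -[1]/(f 0) fpoly_rec ?c_neq0.
- rewrite ppoly1 ppolySS fpoly_rec ?c_neq0 // ppoly0 scalerDr.
  (* Since c_0 = 0, b_0 is the valency k. *)
  have -> : (b 0)%:R = (c 2)%:R + (b 2)%:R :> R by rewrite cbR // -(cbR 0) // c0 add0r.
  by rewrite scalerDl addrCA addrA.
rewrite ppolySS mulrDr IH 1?ltnW //; last by lia.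
rewrite (@fpoly_rec n.+2) ?c_neq0 //.
have -> : p n.+3 = p n.+1 + f n.+3 by rewrite ppolySS.
have -> : (b n.+3)%:R *: p n.+1 = (k%:R - (c n.+3)%:R) *: p n.+1.
  by rewrite -(cbR n.+3) // addrC addKr.
rewrite -(cbR n.+1) //; last by lia.
have -> : (b n.+1)%:R *: f n.+1 =
    (b n.+1)%:R *: p n.+1 - (if n is m.+1 then (b n.+1)%:R *: p m else 0).
  case: n {IH nD} => [|n]; first by rewrite ppoly1 subr0.
  by rewrite -scalerBr ppolySS addrC addKr.
rewrite scalerDr !scalerBl scalerDl.
set q := if n is m.+1 then _ else _.
set u1 := _ *: _; set u2 := _ *: _; set u3 := _ *: _; set u4 := _ *: _.
ring.
Qed.

(** Compare the coefficients of degree [odd n.+1] in [ppoly_rec]: for odd n this is the constant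
    coefficient, where the left side ['X * p n] contributes 0. *)
Lemma Ppoly0_rec n : (n < D)%N ->
  (c n.+1)%:R * P0 n.+1 + (if n is m.+1 then (b n.+1)%:R * P0 m else 0)
  = (~~ odd n)%:R * P0 n.
Proof.
move=> nD; have /polyP/(_ (odd n.+1)) := ppoly_rec nD.
rewrite coefXM coefD coefZ !Ppoly_at0; case: n nD => [|m] nD.
  by rewrite coef0 mul1r /= => ->.
rewrite coefZ Ppoly_at0 /= !negbK => <-.
by case: (odd m); rewrite ?mul1r ?mul0r.
Qed.

Hypothesis b_gt0 : forall i, (i < D)%N -> (0 < b i)%N.

(** By the recursion, c_(n+2) P_(n+2)(0) is - b_(n+2) P_n(0), plus P_(n+1)(0) when n is odd. By
    induction both terms have the sign of (-1)^(n./2 + 1), so they cannot cancel. *)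
Lemma Ppoly0_sign n : (n < D)%N -> 0 < (-1) ^+ n./2 * P0 n.
Proof.
elim/ltn_ind: n => -[|[|n]] IH nD.
- by rewrite Ppoly_at0 ppoly0 expr0 mul1r coef1.
- have := Ppoly0_rec (ltnW nD); rewrite c1 addr0 !mul1r => ->.
  by rewrite Ppoly_at0 ppoly0 coef1.
have rec := @Ppoly0_rec n.+1 (ltnW nD).
have cR : 0 < (c n.+2)%:R :> R by rewrite ltr0n c_gt0 //= ltnW.
rewrite -(pmulr_rgt0 _ cR) mulrCA -[X in _ * X](addrK ((b n.+2)%:R * P0 n)) rec.
rewrite /= negbK mulrBr mulrCA addrC ltr_wpDr //.
  case: (boolP (odd n)) => on; last by rewrite mul0r.
  have /= := IH n.+1 (ltnSn _) (ltnW nD).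
  by rewrite uphalf_half on mul1r => /ltW.
rewrite exprS mulN1r mulNr opprK mulrCA mulr_gt0 ?ltr0n ?b_gt0 ?IH //; lia.
Qed.

Lemma Ppoly0_neq0 n : (n < D)%N -> P0 n != 0.
Proof. by move=> /Ppoly0_sign; apply: contraTneq => ->; rewrite mulr0 ltxx. Qed.

(** In the recursion at n = D - 1, which is odd, the right side vanishes and so does the term with
    b_D, leaving c_D P_D(0) = 0. *)
Lemma Ppoly0_last : b D = 0%N -> ~~ odd D -> (0 < D)%N -> P0 D = 0.
Proof.
case: D b_gt0 c_gt0 Ppoly0_rec => // n _ cn0 rec bD oD _.
have := rec n (ltnSn n); rewrite -[odd n]negbK oD mul0r.
have -> : (if n is m.+1 then (b n.+1)%:R * P0 m else 0) = 0 :> R.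
  by case: (n) bD => // m ->; rewrite mul0r.
rewrite addr0 => /eqP; rewrite mulf_eq0 pnatr_eq0 => /predU1P[cn|/eqP//].
by have := cn0 n.+1; rewrite cn ltnn ltnSn => /(_ isT).
Qed.

Lemma kkS n : kk R c b n.+1 = kk R c b n * (b n)%:R / (c n.+1)%:R.
Proof.
rewrite /kk big_nat_recr //= [X in _ / X]big_nat_recr //= invfM.
by rewrite -!mulrA; congr (_ * _); rewrite mulrCA.
Qed.

Lemma kk_neq0 n : (n <= D)%N -> kk R c b n != 0.
Proof.
elim: n => [|n IH] nD; first by rewrite /kk !big_nil divr1 oner_eq0.
have kn := IH (ltnW nD).
by rewrite kkS mulf_neq0 ?invr_eq0 ?pnatr_eq0 -?lt0n ?c_gt0 //
  mulf_neq0 ?pnatr_eq0 -?lt0n ?b_gt0.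
Qed.

(* [E*_(n+2) A_(n+4) v = gam n *: E*_(n+2) A_n v], and the lowering part of A maps
   [E*_(n+3) A_(n+1) v] to [xi n *: E*_(n+2) A_n v]; see [upper_lower] and
   [drop_upper_xi]. *)
Definition gam n : R :=
  P0 n * (b n.+2)%:R * (b n.+3)%:R / (P0 n.+2 * (c n.+1)%:R * (c n.+2)%:R).

Definition xi n : R :=
  (b n.+2)%:R * (c n.+3)%:R * P0 n * P0 n.+3
  / ((c n.+1)%:R * P0 n.+1 * P0 n.+2).

(** The scalar form of [drop_up_comp] once each lower component is a multiple of an upper one. *)
Lemma xi_gam n : (n.+2 < D)%N ->
  xi n = (b n.+2)%:R + (if n is m.+1 then gam m * (c n)%:R else 0)
         - (c n.+2)%:R * gam n.
Proof.
move=> nD; have rec1 := Ppoly0_rec (ltnW (ltnW nD)).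
have rec3 := Ppoly0_rec nD; rewrite /= negbK in rec3.
have cn i : (i < n.+3)%N -> (c i.+1)%:R != 0 :> R.
  by move=> ?; rewrite pnatr_eq0 -lt0n c_gt0 //; lia.
have Pn i : (i < n.+3)%N -> P0 i != 0 by move=> ?; rewrite Ppoly0_neq0 //; lia.
(* The recursion at n + 2 eliminates P_(n+3)(0). *)
have -> : xi n = (b n.+2)%:R * P0 n * ((~~ odd n)%:R * P0 n.+2 - (b n.+3)%:R * P0 n.+1)
    / ((c n.+1)%:R * P0 n.+1 * P0 n.+2).
  by rewrite -rec3 addrK /xi; congr (_ / _); ring.
(* The recursion at n replaces P_(n-1)(0), which makes the case n = 0 uniform with the others; the
   parity terms then cancel. *)
have -> : (if n is m.+1 then gam m * (c n)%:R else 0) =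
    (b n.+2)%:R * ((~~ odd n)%:R * P0 n - (c n.+1)%:R * P0 n.+1) / ((c n.+1)%:R * P0 n.+1).
  rewrite -rec1 addrAC subrr add0r; case: (n) cn Pn => [|m] cn Pn; first by rewrite mulr0 mul0r.
  by rewrite /gam; field; do ?[apply/andP; split]; first [apply: cn | apply: Pn]; lia.
by rewrite /gam; field; do ?[apply/andP; split]; first [apply: cn | apply: Pn]; lia.
Qed.

Lemma xi_mul_gam n : (n.+3 < D)%N -> xi n * gam n.+1 = (b n.+4)%:R * gam n.
Proof.
move=> nD; rewrite /xi /gam.
have cn i : (i < n.+3)%N -> (c i.+1)%:R != 0 :> R.
  by move=> ?; rewrite pnatr_eq0 -lt0n c_gt0 //; lia.
have Pn i : (i < n.+4)%N -> P0 i != 0 by move=> ?; rewrite Ppoly0_neq0 //; lia.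
by field; do ?[apply/andP; split]; first [apply: cn | apply: Pn]; lia.
Qed.

(** The bound is sharp: at n + 3 = D the factor P_D(0) vanishes, which is what [upper_last]
    exploits. *)
Lemma xi_neq0 n : (n.+3 < D)%N -> xi n != 0.
Proof.
move=> nD; rewrite /xi !mulf_neq0 ?invr_eq0 ?mulf_neq0 ?Ppoly0_neq0 ?pnatr_eq0 -?lt0n ?b_gt0 ?c_gt0 //; lia.
Qed.

(** The coefficient of p_h(A) v in the theorem is [kappa h / kappa i]. *)
Definition kappa n : R := P0 n / (kk R c b n * (b n)%:R * (b n.+1)%:R).

Lemma kappa_neq0 n : (n.+1 < D)%N -> kappa n != 0.
Proof.
move=> nD; have kn : kk R c b n != 0 by rewrite kk_neq0 //; lia.
have Pn : P0 n != 0 by rewrite Ppoly0_neq0 //; lia.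
have bn i : (i < n.+2)%N -> (b i)%:R != 0 :> R.
  by move=> ?; rewrite pnatr_eq0 -lt0n b_gt0 //; lia.
rewrite /kappa mulf_neq0 ?invr_eq0 //; apply: mulf_neq0; last exact: bn.
by apply: mulf_neq0 => //; exact: bn.
Qed.

Lemma gam_kappa n : (n.+3 < D)%N -> kappa n.+2 * gam n = kappa n.
Proof.
move=> nD; rewrite /gam /kappa !kkS.
have cn i : (i < n.+3)%N -> (c i.+1)%:R != 0 :> R.
  by move=> ?; rewrite pnatr_eq0 -lt0n c_gt0 //; lia.
have bn i : (i < n.+4)%N -> (b i)%:R != 0 :> R.
  by move=> ?; rewrite pnatr_eq0 -lt0n b_gt0 //; lia.
have Pn i : (i < n.+4)%N -> P0 i != 0 by move=> ?; rewrite Ppoly0_neq0 //; lia.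
have kn : kk R c b n != 0 by rewrite kk_neq0 //; lia.
by field; do ?[apply/andP; split]; first [exact: kn | apply: cn | apply: bn | apply: Pn]; lia.
Qed.

(** The recursion at n = 1 reads c_2 P_2(0) = - b_2. *)
Lemma gam0 : (2 < D)%N -> gam 0 = - (b 3)%:R.
Proof.
move=> D_gt2; have P0E : P0 0 = 1 by rewrite Ppoly_at0 ppoly0 coef1.
have b2 : (b 2)%:R != 0 :> R by rewrite pnatr_eq0 -lt0n b_gt0.
have P2 : P0 2 != 0 by rewrite Ppoly0_neq0.
have c2 : (c 2)%:R != 0 :> R by rewrite pnatr_eq0 -lt0n c_gt0 //= ltnW.
have := Ppoly0_rec (ltnW D_gt2); rewrite /= P0E mulr1 mul0r => /eqP.
rewrite addr_eq0 => /eqP E; rewrite /gam c1 P0E mul1r mulr1 [P0 2 * _]mulrC E.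
by field.
Qed.

End PolynomialSequences.

(** * Evaluation of real polynomials at a complex matrix *)

Section PolynomialOfMatrix.
Variables (R : realType) (n : nat) (B : 'M[R[i]]_n).
Implicit Types p q : {poly R}.

(** Padding with zero coefficients lets polynomials of different sizes share one summation range. *)
Lemma polymx_wide N p : (size p <= N)%N ->
  polymx p B = \sum_(j < N) (p`_j)%:C *: B ^+ j.
Proof.
move=> pN; rewrite /polymx (big_ord_widen _ (fun j => (p`_j)%:C *: B ^+ j) pN).
rewrite big_mkcond; apply: eq_bigr => j _; case: ltnP => // pj.
by rewrite nth_default // scale0r.
Qed.

Lemma polymxD p q : polymx (p + q) B = polymx p B + polymx q B.
Proof.
have le_pq := size_polyD p q; set N := maxn _ _ in le_pq.
rewrite !(@polymx_wide N) ?leq_maxl ?leq_maxr // -big_split.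
by apply: eq_bigr => j _; rewrite coefD rmorphD scalerDl.
Qed.

Lemma polymxZ a p : polymx (a *: p) B = a%:C *: polymx p B.
Proof.
rewrite (polymx_wide (size_scale_leq a p)) scaler_sumr.
by apply: eq_bigr => j _; rewrite coefZ rmorphM scalerA.
Qed.

Lemma polymxMX p : polymx ('X * p) B = B *m polymx p B.
Proof.
rewrite (@polymx_wide (size p).+1); last first.
  by rewrite (leq_trans (size_polyMleq _ _)) // size_polyX.
rewrite big_ord_recl coefXM scale0r add0r mulmx_sumr.
by apply: eq_bigr => j _; rewrite coefXM -scalemxAr exprS.
Qed.

Lemma polymx1 : polymx 1 B = 1%:M.
Proof. by rewrite /polymx size_poly1 big_ord1 coef1 scale1r. Qed.

End PolynomialOfMatrix.

(** * Relations between distance matrices and dual idempotents *)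

Section Matrices.
Variables (R : realType) (X : finType) (e : rel X) (x : X).
Local Notation M := 'M[R[i]]_#|X|.
Local Notation A h := (distmx R e h).
Local Notation E i := (Estar R e x i).
Local Notation adj := (adjmx R e).

Lemma EstarL i (B : M) y z :
  (E i *m B) y z = (dist e x (enum_val y) == i)%:R * B y z.
Proof.
rewrite mxE (bigD1 y) //= mxE eqxx /= big1 ?addr0 // => w /negPf wy.
by rewrite mxE eq_sym wy mul0r.
Qed.

Lemma EstarR i (B : M) y z :
  (B *m E i) y z = (dist e x (enum_val z) == i)%:R * B y z.
Proof.
rewrite mxE (bigD1 z) //= mxE eqxx /= mulrC big1 ?addr0 // => w /negPf wz.
by rewrite mxE wz mulr0.
Qed.

Lemma Estar_mul i j : E i *m E j = (i == j)%:R *: E i.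
Proof.
apply/matrixP=> y z; rewrite EstarL !mxE.
case: (y == z); rewrite /= ?mulr0 // -!natrM !mulnb; congr (_%:R).
by case: eqP => [->|_]; rewrite ?andbF ?andbT ?[i == j]eq_sym ?andbb //; case: eqP.
Qed.

Hypotheses (conn_e : connected e) (graph_e : simple_graph e).

Lemma distmx0 : A 0 = 1%:M.
Proof. by apply/matrixP=> y z; rewrite !mxE dist_eq0 // (inj_eq enum_val_inj). Qed.

Lemma distmx_large h : (diameter e < h)%N -> A h = 0.
Proof.
move=> Dh; apply/matrixP=> y z; rewrite !mxE; case: eqP => // dh.
by have := dist_le_diameter e (enum_val y) (enum_val z); rewrite dh leqNgt Dh.
Qed.

Lemma Estar_large i : (diameter e < i)%N -> E i = 0.
Proof.
move=> Di; apply/matrixP=> y z; rewrite !mxE; case: eqP => //= _; case: eqP => // di.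
by have := dist_le_diameter e x (enum_val y); rewrite di leqNgt Di.
Qed.

Lemma Estar_distmx_eq0 i h j : (i + j < h)%N || (h + j < i)%N ->
  E i *m A h *m E j = 0.
Proof.
move=> ihj; apply/matrixP=> y z; rewrite EstarR EstarL !mxE.
set dz := dist e x _; set dy := dist e x _; set dyz := dist e _ _.
have [le1 le2] : (dy <= dz + dyz /\ dyz <= dy + dz)%N
  by exact: (dist_triangle_sym conn_e graph_e).
by case: eqP => ?; case: eqP => ?; case: eqP => ?; rewrite ?mul0r ?mulr0 //; lia.
Qed.

Hypothesis bip_e : bipartite e.

(** Bipartiteness excludes edges inside a subconstituent. *)
Lemma Estar_adjmx i : E i.+1 *m adj = E i.+1 *m adj *m (E i + E i.+2).
Proof.
apply/matrixP=> y z; rewrite mulmxDr [RHS]mxE !EstarR !EstarL mxE dist_eq1 //.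
case eyz: (e _ _); rewrite ?mulr0 ?addr0 //.
have := dist_neighbour conn_e graph_e bip_e x eyz; rewrite mulr1 -mulrDl.
set dz := dist e x _; set dy := dist e x _.
case: (dy =P i.+1) => [dyi dzi|_ _]; last by rewrite mulr0.
by rewrite mulr1 -natrD -[LHS]/(1%:R); congr (_%:R); lia.
Qed.

Lemma adjmx_Estar i : adj *m E i.+1 = (E i + E i.+2) *m adj *m E i.+1.
Proof.
apply/matrixP=> y z; rewrite !EstarR mulmxDl [X in _ * X]mxE [in RHS]mxE !EstarL mxE dist_eq1 //.
case eyz: (e _ _); rewrite ?mulr0 ?addr0 ?mulr0 //.
have := dist_neighbour conn_e graph_e bip_e x eyz; rewrite !mulr1.
set dz := dist e x _; set dy := dist e x _.
case: (dz =P i.+1) => [dzi dyi|_ _]; last by rewrite !mul0r.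
by rewrite mul1r -natrD -[LHS]/(1%:R); congr (_%:R); lia.
Qed.

(** The triangle inequality and parity leave only three distances from x for a vertex at distance h
    + 2 from a vertex of the second subconstituent. *)
Lemma distmx_Estar2 h :
  A h.+2 *m E 2 = (E h + E h.+2 + E h.+4) *m A h.+2 *m E 2.
Proof.
apply/matrixP=> y z; rewrite [LHS]EstarR [RHS]EstarR !mulmxDl.
rewrite [in RHS]mxE [X in _ * (X + _)]mxE !EstarL !mxE -!mulrDl.
set dz := dist e x _; set dy := dist e x _; set dyz := dist e _ _.
case: (dz =P 2) => [dz2|_]; last by rewrite !mul0r.
case: (dyz =P h.+2) => [dyz_h|_]; rewrite ?mulr0 // !mul1r mulr1.
have [le1 le2] : (dy <= dz + dyz /\ dyz <= dy + dz)%N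
  by exact: (dist_triangle_sym conn_e graph_e).
have par : odd dyz = odd dy (+) odd dz
  by exact: (dist_parity_sym conn_e graph_e bip_e).
rewrite dz2 dyz_h in le1 le2 par.
by rewrite -!natrD -[LHS]/(1%:R); congr (_%:R); lia.
Qed.

(* Given z at distance 2 from x, a vertex y at distance n+2 from x is at
   distance n, n+2 or n+4 from z. *)
Lemma Estar_distmx_sum n :
  E n.+2 *m (A n + A n.+2 + A n.+4) *m E 2 = E n.+2 *m const_mx 1 *m E 2.
Proof.
apply/matrixP=> y z; rewrite !EstarR !EstarL !mxE.
set dz := dist e x _; set dy := dist e x _; set dyz := dist e _ _.
case: (dz =P 2) => [dz2|_]; last by rewrite !mul0r.
case: (dy =P n.+2) => [dy_n|_]; last by rewrite !mul0r.
rewrite !mul1r.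
have [le1 le2] : (dy <= dz + dyz /\ dyz <= dy + dz)%N
  by exact: (dist_triangle_sym conn_e graph_e).
have par : odd dyz = odd dy (+) odd dz
  by exact: (dist_parity_sym conn_e graph_e bip_e).
rewrite dz2 dy_n in le1 le2 par.
by rewrite -!natrD -[RHS]/(1%:R); congr (_%:R); lia.
Qed.

Variables c b : nat -> nat.
Hypothesis dreg_e : distance_regular e c b.

(** Distance-regularity in a form valid for every j: the count is zero unless the distance from y to
    z is j - 1 or j + 1. It gives the entries of [adj *m A j]. *)
Lemma card_neighbours_at (y z : X) j : #|[set w | e z w & dist e y w == j]| =
  ((if j is m.+1 then (dist e y z == m) * b m else 0) + (dist e y z == j.+1) * c j.+1)%N.
Proof.
have [cE bE] := dreg_e y z; have nbr w := @dist_neighbour X e conn_e graph_e bip_e y z w.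
have [dj|dj] := eqVneq (dist e y z) j.+1.
  have -> : (if j is m.+1 then (dist e y z == m) * b m else 0)%N = 0%N.
    by case: (j) dj => // m ->; case: eqP => //; lia.
  rewrite dj in cE; rewrite mul1n -cE; apply: eq_card => w; rewrite !inE; lia.
rewrite mul0n addn0.
case: j dj => [|m] dj; last have [dm|dm] := eqVneq (dist e y z) m.
- apply/eqP; rewrite cards_eq0; apply/eqP/setP=> w; rewrite !inE.
  by case: (boolP (e z w)) => //= /nbr; lia.
- by rewrite dm mul1n in bE *; apply: etrans bE; apply: eq_card => w; rewrite !inE.
rewrite mul0n; apply/eqP; rewrite cards_eq0; apply/eqP/setP=> w; rewrite !inE.
by case: (boolP (e z w)) => //= /nbr; lia.
Qed.

Lemma adjmx_distmx j :
  adj *m A j = (if j is m.+1 then (b m)%:R *: A m else 0) + (c j.+1)%:R *: A j.+1.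
Proof.
apply/matrixP=> y z; rewrite !mxE.
pose F (w : X) : R[i] := (e (enum_val y) w && (dist e (enum_val z) w == j))%:R.
transitivity (\sum_(w : X) F w).
  rewrite (reindex _ (onW_bij _ (@enum_val_bij X))); apply: eq_bigr => w _.
  by rewrite !mxE -natrM mulnb dist_eq1 // [dist e _ (enum_val z)]dist_sym.
have -> : \sum_w F w = #|[set w | e (enum_val y) w & dist e (enum_val z) w == j]|%:R.
  by rewrite -sum1dep_card natr_sum [RHS]big_mkcond; apply: eq_bigr => w _;
    rewrite /F; case: (_ && _).
rewrite card_neighbours_at natrD mulnC natrM; congr (_ + _ * _%:R); last by rewrite dist_sym.
by case: j {F} => [|m]; rewrite !mxE // mulnC natrM dist_sym.
Qed.

(** The recursion defining [fpoly] is [adjmx_distmx] solved for A_(h+1). *)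
Lemma polymx_fpoly h :
  (forall i, (0 < i <= diameter e)%N -> (0 < c i)%N) -> c 1 = 1%N ->
  (h <= diameter e)%N -> polymx (fpoly R c b h) adj = A h.
Proof.
move=> c_gt0 c1; elim/ltn_ind: h => -[|h] IH hD; first by rewrite polymx1 distmx0.
have ch : (c h.+1)%:R != 0 :> R[i] by rewrite pnatr_eq0 -lt0n c_gt0.
rewrite [fpoly _ _ _ _]/= -scaleN1r polymxZ polymxD polymxMX IH ?(ltnW hD) // polymxZ.
rewrite adjmx_distmx fmorphV rmorph_nat rmorphN1 scaleN1r.
have -> : polymx (if h is l.+1 then (b l)%:R *: fpoly R c b l else 0) adj
  = (if h is m.+1 then (b m)%:R *: A m else 0).
  case: h IH hD ch => [|h] IH hD ch; first by rewrite /polymx size_poly0 big_ord0.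
  by rewrite polymxZ rmorph_nat IH //; lia.
by rewrite addrAC subrr add0r scalerA mulVf // scale1r.
Qed.

End Matrices.

(** * Action of A on the outer components of A_n v *)

Section EndpointTwo.
Variables (R : realType) (X : finType) (e : rel X) (x : X).
Local Notation M := 'M[R[i]]_#|X|.
Local Notation A h := (distmx R e h).
Local Notation E i := (Estar R e x i).
Local Notation adj := (adjmx R e).

Hypotheses (conn_e : connected e) (graph_e : simple_graph e) (bip_e : bipartite e).
Variables (c b : nat -> nat).
Hypotheses (dreg_e : distance_regular e c b).

Variable v : 'cV[R[i]]_#|X|.
Hypothesis v2 : E 2 *m v = v.
(** [up_comp n] is indexed by its distance matrix and [down_comp n] by its subconstituent, so
    [up_comp n] and [down_comp n.+2] lie in the same E*_(n+2) V. *)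
Definition up_comp n := E n.+2 *m A n *m v.
Definition down_comp n := E n *m A n.+2 *m v.

Lemma Estar_distmx_v0 i h : (i + 2 < h)%N || (h + 2 < i)%N -> E i *m A h *m v = 0.
Proof. by move=> ih; rewrite -v2 mulmxA Estar_distmx_eq0 // mul0mx. Qed.

(* Compare the E*_i-components of A A_j v and of its expansion by the
   three-term recurrence of the distance matrices. *)
Lemma Estar_adjmx_v i j :
  E i.+1 *m adj *m (E i *m A j *m v) + E i.+1 *m adj *m (E i.+2 *m A j *m v)
  = (if j is m.+1 then (b m)%:R *: (E i.+1 *m A m *m v) else 0)
    + (c j.+1)%:R *: (E i.+1 *m A j.+1 *m v).
Proof.
transitivity (E i.+1 *m (adj *m A j) *m v).
  by rewrite [in RHS]mulmxA [in RHS]Estar_adjmx // mulmxDr 2!mulmxDl !mulmxA.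
rewrite (adjmx_distmx R conn_e graph_e bip_e dreg_e).
rewrite mulmxDr mulmxDl -scalemxAr -scalemxAl; congr (_ + _).
by case: j => [|m]; rewrite ?mulmx0 ?mul0mx // -scalemxAr -scalemxAl.
Qed.

(** In [Estar_adjmx_v] the triangle inequality kills every other term, as v is supported at distance
    2 from x. [drop_down_comp] is the mirror case. *)
Lemma raise_up_comp n : E n.+3 *m adj *m up_comp n = (c n.+1)%:R *: up_comp n.+1.
Proof.
have := Estar_adjmx_v n.+2 n.
rewrite (@Estar_distmx_v0 n.+4) ?mulmx0 ?addr0; last by lia.
move=> ->; case: n => [|m]; rewrite ?add0r // Estar_distmx_v0 ?scaler0 ?add0r //; lia.
Qed.

Lemma drop_down_comp n : E n.+1 *m adj *m down_comp n.+2 = (b n.+3)%:R *: down_comp n.+1.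
Proof.
have := Estar_adjmx_v n n.+4.
rewrite (@Estar_distmx_v0 n) ?mulmx0 ?add0r; last by lia.
by move=> ->; rewrite [X in _ + _ *: X]Estar_distmx_v0 ?scaler0 ?addr0 //; lia.
Qed.

Hypothesis v_sum0 : (const_mx 1 : M) *m v = 0.

(** The three matrices A_n, A_(n+2), A_(n+4) together act between these subconstituents as the
    all-ones matrix, which kills v. *)
Lemma Estar_middle n : E n.+2 *m A n.+2 *m v = - (up_comp n + down_comp n.+2).
Proof.
apply/eqP; rewrite -addr_eq0 addrCA addrA /up_comp /down_comp -!mulmxDl -!mulmxDr; apply/eqP.
by rewrite -v2 mulmxA Estar_distmx_sum // -!mulmxA v2 v_sum0 mulmx0.
Qed.

Local Notation D := (diameter e).
Variable k : nat.
Hypotheses (c_gt0 : forall i, (0 < i <= D)%N -> (0 < c i)%N)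
  (c0 : c 0 = 0%N) (c1 : c 1 = 1%N).
Hypothesis cb : forall i, (i <= D)%N -> (c i + b i)%N = k.
Hypotheses (E02 : E 0 *m A 2 *m v = 0) (E11 : E 1 *m A 1 *m v = 0)
  (E13 : E 1 *m A 3 *m v = 0).

(** Take the E*_(n+2)-component of A A_(n+1) v and rewrite both middle components by [Estar_middle].
    The coefficient of [up_comp n] becomes b_n + c_n - c_(n+2), which equals b_(n+2). *)
Lemma drop_up_comp n : (n.+2 <= D)%N ->
  E n.+2 *m adj *m up_comp n.+1 =
  (b n.+2)%:R *: up_comp n + E n.+2 *m adj *m down_comp n.+1 - (c n.+2)%:R *: down_comp n.+2.
Proof.
move=> nD; have := Estar_adjmx_v n.+1 n.+1.
rewrite Estar_middle -/(up_comp n.+1) -/(up_comp n).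
have bE : (b n)%:R = (c n.+2)%:R + (b n.+2)%:R - (c n)%:R :> R[i].
  by rewrite -natrD cb // -(cb (ltnW (ltnW nD))) natrD addrAC subrr add0r.
case: n nD bE => [|n] nD bE.
  (* For n = 0 the terms below the endpoint vanish, and c_0 = 0. *)
  rewrite E11 mulmx0 add0r => ->; rewrite /(down_comp 1) E13 mulmx0 addr0.
  by rewrite bE c0 subr0 scalerDl scalerN scalerDr opprD addrACA subrr add0r.
rewrite Estar_middle mulmxN mulmxDr raise_up_comp => /eqP.
rewrite addrC subr_eq => /eqP->; rewrite bE scalerBl scalerDl scalerN scalerDr.
set u1 := _ *: _; set u2 := _ *: _; set u3 := _ *: _; set u4 := _ *: _; set u5 := _ *m _.
clearbody u1 u2 u3 u4 u5.
by apply/matrixP=> y z; rewrite !mxE; ring.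
Qed.

Lemma up_comp0 : up_comp 0 = v.
Proof. by rewrite /up_comp distmx0 // mulmx1. Qed.

Lemma distmx_v h : A h.+2 *m v = down_comp h + E h.+2 *m A h.+2 *m v + up_comp h.+2.
Proof.
by rewrite /down_comp /up_comp -!mulmxDl -{1}v2 mulmxA distmx_Estar2 // -[LHS]mulmxA v2.
Qed.

(** In passing from p_h to p_(h+2), the middle and lowest components of A_(h+2) v cancel
    [up_comp h - down_comp h] and leave [- down_comp h.+2]. *)
Lemma ppoly_v h : (h <= D)%N -> polymx (ppoly R c b h) adj *m v = up_comp h - down_comp h.
Proof.
elim/ltn_ind: h => -[|[|h]] IH hD.
- by rewrite ppoly0 polymx1 mul1mx up_comp0 /down_comp E02 subr0.
- rewrite ppoly1 polymx_fpoly // -{1}v2 mulmxA adjmx_Estar // -[LHS]mulmxA v2.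
  by rewrite 2!mulmxDl E11 add0r /down_comp E13 subr0.
rewrite ppolySS polymxD polymx_fpoly // mulmxDl IH //; last by lia.
rewrite distmx_v Estar_middle.
move: (up_comp h) (up_comp h.+2) (down_comp h) (down_comp h.+2) => u1 u2 u3 u4.
by apply/matrixP=> y z; rewrite !mxE; ring.
Qed.

End EndpointTwo.

(** Negation reverses the order, so - theta_d occurs at an index at most d ([up]) and at an index at
    least d ([down]), where d = D/2. Hence theta_d <= - theta_d <= theta_d. *)
Lemma decreasing_symmetric_mid (R : realType) (D : nat) (theta : nat -> R) :
  (forall i j, (i < j)%N -> (j <= D)%N -> theta j < theta i) ->
  (forall i, (i <= D)%N -> exists2 j, (j <= D)%N & theta j = - theta i) ->
  ~~ odd D -> theta D./2 = 0.
Proof.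
move=> decr sym D_even.
have theta_lt i j : (i <= D)%N -> theta j < theta i -> (i < j)%N.
  move=> iD; rewrite ltnNge; apply: contraTN => ji; rewrite -leNgt.
  by move: ji; rewrite leq_eqVlt => /predU1P[->//|/decr/(_ iD)/ltW].
(* Each increase of i forces a strictly smaller index for - theta_i. *)
have up i : (i <= D)%N -> exists2 j, (j <= D - i)%N & theta j = - theta i.
  elim: i => [|i IH] iD.
    by have [j jD tj] := sym 0%N iD; exists j; rewrite ?subn0.
  have [j jD tj] := IH (ltnW iD); have [j' j'D tj'] := sym _ iD; exists j' => //.
  have: (j' < j)%N by rewrite theta_lt // tj tj' ltrN2 decr.
  by lia.
have down i : (i <= D)%N -> exists2 j, (i <= j <= D)%N & theta j = - theta (D - i)%N.
  elim: i => [|i IH] iD.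
    by have [j jD tj] := sym _ (leqnn D); exists j; rewrite ?subn0.
  have [j /andP[ij jD] tj] := IH (ltnW iD).
  have [j' j'D tj'] := sym (D - i.+1)%N (leq_subr _ _); exists j' => //.
  have: (j < j')%N by rewrite theta_lt // tj tj' ltrN2 decr //; lia.
  by rewrite j'D andbT; lia.
have dD : (D./2 <= D)%N by lia.
have DdE : (D - D./2 = D./2)%N by lia.
have mono i j : (i <= j <= D)%N -> theta j <= theta i.
  by case/andP; rewrite leq_eqVlt => /predU1P[->//|/decr H /H/ltW].
have [j] := up _ dD; rewrite DdE => jd tj.
have [l] := down _ dD; rewrite DdE => dl tl.
have := mono _ _ dl; have := mono j D./2; rewrite jd dD tj tl => /(_ isT).
by lra.
Qed.

(** * Symmetry of the spectrum, and basic facts on T-modules *)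

Section Modules.
Variables (R : realType) (X : finType) (e : rel X) (x : X).
Local Notation M := 'M[R[i]]_#|X|.
Local Notation A h := (distmx R e h).
Local Notation E i := (Estar R e x i).
Local Notation adj := (adjmx R e).
Hypotheses (conn_e : connected e) (graph_e : simple_graph e) (bip_e : bipartite e).

(** Changing the sign of an eigenvector on one side of the bipartition negates its eigenvalue. *)
Lemma eigenvalue_adjmx_opp z : eigenvalue adj z -> eigenvalue adj (- z).
Proof.
have [s s_edge _] := bipartite_side conn_e bip_e.
case/eigenvalueP=> u uA u0.
pose u' : 'rV[R[i]]_#|X| := \row_j ((-1) ^+ s (enum_val j) * u 0 j).
apply/eigenvalueP; exists u'.
  apply/rowP=> j; have /rowP/(_ j) := uA; rewrite !mxE => E.
  transitivity (- ((-1) ^+ s (enum_val j) * \sum_l u 0 l * adj l j)).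
    rewrite big_distrr /= -sumrN; apply: eq_bigr => l _; rewrite !mxE dist_eq1 //.
    case elj: (e _ _); rewrite ?mulr0 ?oppr0 // !mulr1.
    by rewrite (s_edge _ _ elj); case: (s _); rewrite ?expr0 ?expr1; ring.
  by rewrite E; ring.
apply: contraNneq u0 => /rowP u'0; apply/eqP/rowP=> j; have := u'0 j.
by rewrite !mxE => /eqP; rewrite mulf_eq0 signr_eq0 => /eqP.
Qed.

Lemma Talg_distmx (c b : nat -> nat) h : distance_regular e c b ->
  (forall i, (0 < i <= diameter e)%N -> (0 < c i)%N) -> Talg e x (A h).
Proof.
move=> dreg_e c_gt0; have [hD|Dh] := leqP h (diameter e); last first.
  by rewrite distmx_large // -(scale0r 1%:M); apply/Talg_scale/Talg_one.
elim/ltn_ind: h hD => -[|h] IH hD; first by rewrite distmx0 //; apply: Talg_one.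
have ch : (c h.+1)%:R != 0 :> R[i] by rewrite pnatr_eq0 -lt0n c_gt0.
have -> : A h.+1 = (c h.+1)%:R^-1 *: (adj *m A h
    + -1 *: (if h is m.+1 then (b m)%:R *: A m else 0)).
  by rewrite (adjmx_distmx _ conn_e graph_e bip_e dreg_e) scaleN1r addrAC subrr add0r
       scalerA mulVf ?scale1r.
apply/Talg_scale/Talg_add.
  by apply: Talg_mul; [apply: Talg_adj | apply: IH => //; apply: ltnW].
apply: Talg_scale; case: h IH hD {ch} => [|h] IH hD.
  by rewrite -(scale0r 1%:M); apply/Talg_scale/Talg_one.
by apply/Talg_scale/IH => //; lia.
Qed.

Lemma mem_EstarW i (W : {vspace 'cV[R[i]]_#|X|}) w :
  w \in W -> E i *m w \in EstarW e x i W.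
Proof. by move=> wW; rewrite -[_ *m _](lfunE (mulmx (E i))) memv_img. Qed.

Lemma EstarWP i (W : {vspace 'cV[R[i]]_#|X|}) w :
  w \in EstarW e x i W -> exists2 w', w' \in W & w = E i *m w'.
Proof. by case/memv_imgP=> w' w'W ->; exists w' => //; rewrite lfunE. Qed.

Lemma line_scale (F : fieldType) (V : vectType F) (U : {vspace V}) u w :
  (\dim U <= 1)%N -> u \in U -> u != 0 -> w \in U -> exists t, w = t *: u.
Proof.
move=> dU uU u0 wU; apply/vlineP; suff -> : <[u]>%VS = U by [].
by apply/eqP; rewrite eqEdim dim_vline u0 dU -memvE uU.
Qed.

(** Such a u is a common eigenvector of the generators, hence of all of T. *)
Lemma Tmodule_line u i : (i <= diameter e)%N -> E i *m u = u -> adj *m u = 0 ->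
  Tmodule e x <[u]>%VS.
Proof.
move=> iD Eu Au B w TB /vlineP[t ->].
suff [s Bu] : exists s, B *m u = s *: u.
  by rewrite -scalemxAr Bu; apply/rpredZ/rpredZ/memv_line.
elim: TB => [|j jD||B1 B2 _ [s1 B1u] _ [s2 B2u]|a B1 _ [s B1u]|B1 B2 _ [s1 B1u] _ [s2 B2u]].
- by exists 0; rewrite scale0r.
- exists (j == i)%:R; rewrite -Eu mulmxA Estar_mul -scalemxAl.
  by case: eqP => [->|]; rewrite ?scale1r // !scale0r.
- by exists 1; rewrite mul1mx scale1r.
- by exists (s1 + s2); rewrite mulmxDl B1u B2u scalerDl.
- by exists (a * s); rewrite -scalemxAl B1u scalerA.
by exists (s2 * s1); rewrite -mulmxA B2u -scalemxAr B1u scalerA.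
Qed.

End Modules.

(** * The thin irreducible module with local eigenvalue b_3 - 1 *)

Section ThinModule.
Variables (R : realType) (X : finType) (e : rel X) (x : X).
Local Notation M := 'M[R[i]]_#|X|.
Local Notation A h := (distmx R e h).
Local Notation E i := (Estar R e x i).
Local Notation adj := (adjmx R e).
Hypotheses (conn_e : connected e) (graph_e : simple_graph e) (bip_e : bipartite e).
Variables (c b : nat -> nat) (k : nat).
Hypotheses (dreg_e : distance_regular e c b) (val_e : regular_of_valency e k).
Local Notation D := (diameter e).
Hypotheses (D_even : ~~ odd D) (D_ge4 : (4 <= D)%N).
Variables (W : {vspace 'cV[R[i]]_#|X|}) (v : 'cV[R[i]]_#|X|).
Hypotheses (irr_W : irreducible_Tmodule e x W) (thin_W : thin e x W)
    (endpt_W : has_endpoint e x W 2)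
    (local_W : has_local_eigenvalue e x W ((b 3)%:R - 1))
    (v_in : v \in EstarW e x 2 W) (v_neq0 : v != 0).

Let c_gt0 i : (0 < i <= D)%N -> (0 < c i)%N.
Proof. exact: (c_pos conn_e graph_e dreg_e x). Qed.
Let b_gt0 i : (i < D)%N -> (0 < b i)%N.
Proof. exact: (b_pos conn_e dreg_e x). Qed.
Let c0 : c 0 = 0%N. Proof. exact: (c_0 dreg_e x). Qed.
Let c1 : c 1 = 1%N. Proof. by apply: (c_1 conn_e graph_e dreg_e x); lia. Qed.
Let cb i : (i <= D)%N -> (c i + b i)%N = k.
Proof. exact: (cb_valency conn_e graph_e bip_e dreg_e x). Qed.
Let bD : b D = 0%N. Proof. exact: (b_diameter conn_e dreg_e x). Qed.

Let W_Tmod : Tmodule e x W. Proof. by case: irr_W. Qed.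

Let v2 : E 2 *m v = v.
Proof. by have [w _ ->] := EstarWP v_in; rewrite mulmxA Estar_mul eqxx scale1r. Qed.

Let vW : v \in W.
Proof.
have [w wW ->] := EstarWP v_in; apply: W_Tmod wW.
by apply: Talg_Estar; lia.
Qed.

Let Av_W h : A h *m v \in W.
Proof. by apply: W_Tmod vW; apply: (Talg_distmx _ _ conn_e graph_e bip_e _ dreg_e). Qed.

Let Estar_small i w : (i < 2)%N -> w \in W -> E i *m w = 0.
Proof.
move=> i2 wW; have [_ /(_ i i2) EW0] := endpt_W.
by have := mem_EstarW e x i wW; rewrite EW0 memv0 => /eqP.
Qed.

Let E_small i h : (i < 2)%N -> E i *m A h *m v = 0.
Proof. by move=> i2; rewrite -mulmxA Estar_small. Qed.

(** As v is supported at distance 2 from x, the sum of its entries is the x-entry of A_2 v, which is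
    zero because E*_0 W = 0. *)
Let v_sum0 : (const_mx 1 : M) *m v = 0.
Proof.
have coord z : v z 0 = (dist e x (enum_val z) == 2)%:R * v z 0.
  have /matrixP/(_ z 0) := v2; rewrite mxE (bigD1 z) //= mxE eqxx /= big1 ?addr0 // => w.
  by rewrite mxE eq_sym => /negPf->; rewrite mul0r.
apply/matrixP=> y z; rewrite (ord1 z) mxE [RHS]mxE.
have /matrixP/(_ (enum_rank x) 0) := E_small 2 (isT : 0 < 2)%N.
rewrite -mulmxA mxE (bigD1 (enum_rank x)) //= mxE eqxx enum_rankK dist_refl //= mul1r.
rewrite big1 ?addr0; last by move=> w; rewrite mxE eq_sym => /negPf->; rewrite mul0r.
rewrite [in X in _ = X -> _]mxE mxE => {2}<-; apply: eq_bigr => w _.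
by rewrite !mxE enum_rankK mul1r -coord.
Qed.

Local Notation upper := (up_comp e x v).
Local Notation lower := (down_comp e x v).

Let lower1 : lower 1 = 0. Proof. exact: E_small. Qed.
Let upper0_v : upper 0 = v. Proof. exact: up_comp0. Qed.
Let upperW n : upper n \in EstarW e x n.+2 W.
Proof. by rewrite /up_comp -mulmxA mem_EstarW. Qed.
Let lowerW n : lower n \in EstarW e x n W.
Proof. by rewrite /down_comp -mulmxA mem_EstarW. Qed.

Let gamC n : R[i] := (gam R c b n)%:C.
Let xiC n : R[i] := (xi R c b n)%:C.

(** The proportionality is a hypothesis so that this applies both inside the induction of
    [upper_lower] and after it. *)
Let drop_upper_xi n : (n.+2 < D)%N ->
  (forall m, (m <= n)%N -> lower m.+2 = gamC m *: upper m) ->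
  E n.+2 *m adj *m upper n.+1 = xiC n *: upper n.
Proof.
move=> nD lowerE.
rewrite (drop_up_comp conn_e graph_e bip_e dreg_e v2 v_sum0 c0 cb) ?E_small //; last exact: ltnW.
rewrite lowerE // /xiC (xi_gam R c_gt0 c0 c1 cb b_gt0) // rmorphB rmorphD rmorphM !rmorph_nat.
rewrite scalerBl scalerDl scalerA; congr (_ + _ - _).
case: n nD lowerE => [|n] nD lowerE; first by rewrite lower1 mulmx0 scale0r.
rewrite lowerE ?ltnS // -scalemxAr (raise_up_comp conn_e graph_e bip_e dreg_e) // scalerA.
by rewrite rmorphM rmorph_nat.
Qed.

(** The middle component of A_2 v is (b_3 - 1) v by the local eigenvalue and - (v + [lower 2]) by
    [Estar_middle]. *)
Let lower2 : lower 2 = gamC 0 *: upper 0.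
Proof.
have := Estar_middle conn_e graph_e bip_e v2 v_sum0 0.
have <- : E 2 *m A 2 *m E 2 *m v = E 2 *m A 2 *m v by rewrite -[LHS]mulmxA v2.
rewrite local_W // upper0_v => H.
have -> : lower 2 = - (((b 3)%:R - 1) *: v) - v by rewrite H opprK addrAC subrr add0r.
rewrite /gamC (gam0 R c_gt0 c0 c1 cb b_gt0); last by lia.
by rewrite rmorphN rmorph_nat scalerBl scale1r opprB addrAC subrr add0r scaleNr.
Qed.

(** Both claims are needed together: the lowering part of A takes [upper n.+1] to a nonzero multiple
    of [upper n], so it is nonzero and, by thinness, spans a line containing [lower n.+3]. *)
Let upper_lower n : (n.+2 < D)%N -> upper n != 0 /\ lower n.+2 = gamC n *: upper n.
Proof.
elim/ltn_ind: n => -[|n] IH nD; first by rewrite upper0_v; split=> //; rewrite lower2 upper0_v.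
have drop_n : E n.+2 *m adj *m upper n.+1 = xiC n *: upper n.
  by apply: drop_upper_xi => [|m mn]; [apply: ltnW | apply: (proj2 (IH m _ _)); lia].
have [un0 ln] := IH n (ltnSn n) (ltnW nD).
have xi0 : xiC n != 0 by rewrite fmorph_eq0 (xi_neq0 R c_gt0 c0 c1 cb b_gt0).
have u0 : upper n.+1 != 0.
  by apply: contraNneq un0 => u0; move: drop_n; rewrite u0 mulmx0 => /esym/eqP;
     rewrite scaler_eq0 (negPf xi0).
split=> //.
have [t lt] := @line_scale _ _ (EstarW e x n.+3 W) _ _
  (thin_W (ltnW nD)) (upperW n.+1) u0 (lowerW n.+3).
(* Lowering [lower n.+3 = t *: upper n.+1] in two ways gives t xi_n = b_(n+4) gam_n, and
   [xi_mul_gam] identifies t. *)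
have := drop_down_comp conn_e graph_e bip_e dreg_e v2 n.+1.
rewrite lt -scalemxAr drop_n ln !scalerA => /eqP.
rewrite -subr_eq0 -scalerBl scaler_eq0 (negPf un0) orbF.
rewrite subr_eq0 => /eqP E; congr (_ *: _).
apply: (mulfI xi0); rewrite mulrC E -[RHS]rmorphM /=.
by rewrite (xi_mul_gam R c_gt0 c0 c1 cb b_gt0) // rmorphM rmorph_nat.
Qed.

Lemma upper_last : upper (D - 2) = 0.
Proof.
have -> : (D - 2 = (D - 3).+1)%N by lia.
have n3 : ((D - 3).+2 < D)%N by lia.
set n := (D - 3)%N in n3 *.
have nD : D = n.+3 by rewrite /n; lia.
have drop_n : E n.+2 *m adj *m upper n.+1 = xiC n *: upper n.
  by apply: drop_upper_xi => // m mn; apply: (proj2 (upper_lower _)); lia.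
have xi0 : xiC n = 0.
  rewrite /xiC /xi -nD (Ppoly0_last R c_gt0 c0 c1 cb b_gt0 bD D_even); last by lia.
  by rewrite mulr0 mul0r.
have Eu : E D *m upper n.+1 = upper n.+1.
  by rewrite /up_comp -nD -mulmxA mulmxA Estar_mul eqxx scale1r.
(* There is no subconstituent beyond D, so A can only lower this vector, with factor xi_(D-3) =
   0. *)
have Au : adj *m upper n.+1 = 0.
  rewrite -Eu mulmxA {1}nD adjmx_Estar // -nD (Estar_large _ _ (ltnSn D)) addr0.
  by rewrite -!mulmxA Eu mulmxA drop_n xi0 scale0r.
apply/eqP/negP => /negP u0.
have [_ _ /(_ <[upper n.+1]>%VS)] := irr_W.
case; first exact: (Tmodule_line (leqnn D)).
- have [w wW ->] := EstarWP (upperW n.+1); rewrite -memvE; apply: W_Tmod wW.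
  by apply: Talg_Estar; rewrite -nD.
- by move=> /eqP; rewrite -dimv_eq0 dim_vline u0.
(* If the line were all of W, then v would lie in both E*_2 V and E*_D V, although D >= 4. *)
move=> UW; case/negP: v_neq0; move: vW; rewrite -UW => /vlineP[t vt].
by rewrite -v2 vt -Eu -scalemxAr mulmxA Estar_mul nD scale0r mul0mx scaler0.
Qed.

(** By [gam_kappa], [kappa h.+2] times [lower h.+2] equals [kappa h] times [upper h], so only the
    last upper term survives. *)
Lemma sum_kappa_ppoly i : (i <= D - 2)%N ->
  \sum_(h < i.+1 | ~~ odd (i - h))
     (kappa R c b h)%:C *: (polymx (ppoly R c b h) adj *m v)
  = (kappa R c b i)%:C *: upper i.
Proof.
move=> iD; pose F h := (kappa R c b h)%:C *: (upper h - lower h).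
transitivity (\sum_(h < i.+1 | ~~ odd (i - h)) F h).
  apply: eq_bigr => h _; rewrite (ppoly_v conn_e graph_e bip_e dreg_e v2 v_sum0) ?E_small //.
  by have := ltn_ord h; lia.
elim/ltn_ind: i iD => -[|[|i]] IH iD.
- by rewrite big_mkcond big_ord1 /F /= [lower 0]E_small // subr0.
- by rewrite big_mkcond !big_ord_recr big_ord0 /= !add0r /F lower1 subr0.
rewrite big_same_parity_recr IH //; last by lia.
have iD' : (i.+3 < D)%N by lia.
rewrite /F (proj2 (upper_lower (ltnW iD'))) scalerBr scalerA -rmorphM.
by rewrite (gam_kappa R c_gt0 c0 c1 cb b_gt0) // addrC subrK.
Qed.

Lemma upper_eq_sum_ppoly i : (i <= D - 2)%N ->
  upper i = \sum_(h < i.+1 | ~~ odd (i - h))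
    ((Ppoly R c b h).[0] / (Ppoly R c b i).[0]
     * ((kk R c b i * (b i)%:R * (b i.+1)%:R)
        / (kk R c b h * (b h)%:R * (b h.+1)%:R)))%:C
    *: (polymx (ppoly R c b h) adj *m v).
Proof.
move=> iD; have ki : (kappa R c b i)%:C != 0 :> R[i].
  by rewrite fmorph_eq0 (kappa_neq0 R c_gt0 c0 c1 cb b_gt0) //; lia.
apply: (scalerI ki); rewrite -sum_kappa_ppoly // scaler_sumr; apply: eq_bigr => h _.
rewrite scalerA -rmorphM; congr (_%:C *: _); rewrite /kappa.
have bn j : (j < D)%N -> (b j)%:R != 0 :> R by move=> ?; rewrite pnatr_eq0 -lt0n b_gt0.
have Pi : (Ppoly R c b i).[0] != 0.
  by rewrite (Ppoly0_neq0 R c_gt0 c0 c1 cb b_gt0) //; lia.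
have kn j : (j <= D - 2)%N -> kk R c b j != 0.
  by move=> ?; rewrite (kk_neq0 R c_gt0 b_gt0) //; lia.
have hi := ltn_ord h.
by field; do ?[apply/andP; split]; first [exact: Pi | apply: bn | apply: kn]; lia.
Qed.

End ThinModule.

Theorem theorem14p3 (R : realType) (X : finType) (e : rel X)
    (c b : nat -> nat) (D d k : nat) (theta : nat -> R) (x : X)
    (W : {vspace 'cV[R[i]]_#|X|}) (v : 'cV[R[i]]_#|X|)
    (graph_e : simple_graph e) (conn_e : connected e) (bip_e : bipartite e)
    (dreg_e : distance_regular e c b)
    (diam_e : diameter e = D) (D_even : ~~ odd D) (D_ge4 : (4 <= D)%N)
    (def_d : d = D./2)
    (val_e : regular_of_valency e k) (k_ge3 : (3 <= k)%N)
    (theta_decr : forall i j, (i < j)%N -> (j <= D)%N -> theta j < theta i)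
    (theta_eig : forall z : R[i],
       eigenvalue (adjmx R e) z <-> exists2 i, (i <= D)%N & z = (theta i)%:C)
    (irr_W : irreducible_Tmodule e x W) (thin_W : thin e x W)
    (endpt_W : has_endpoint e x W 2)
    (local_W : has_local_eigenvalue e x W
       (- 1 - (b 2%N)%:R * (b 3%N)%:R * (theta d ^+ 2 - (b 2%N)%:R)^-1)%:C)
    (v_in : v \in EstarW e x 2 W) (v_neq0 : v != 0) :
  let lhs (i : nat) := Estar R e x (i + 2)%N *m distmx R e i *m v in
  let rhs (i : nat) :=
    \sum_(h < i.+1 | ~~ odd (i - h))
      ((Ppoly R c b h).[0] / (Ppoly R c b i).[0]
       * ((kk R c b i * (b i)%:R * (b i.+1)%:R)
          / (kk R c b h * (b h)%:R * (b h.+1)%:R)))%:C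
      *: (polymx (ppoly R c b h) (adjmx R e) *m v) in
  (forall i : nat, (i <= D - 2)%N -> lhs i = rhs i)
  /\ lhs (D - 2)%N = 0 /\ rhs (D - 2)%N = 0.
Proof.
subst D d; set D := diameter e in D_even D_ge4 theta_decr theta_eig local_W *.
(* Bipartiteness makes the set of eigenvalues closed under negation. *)
have theta_mid : theta D./2 = 0.
  apply: decreasing_symmetric_mid theta_decr _ D_even => i iD.
  have /theta_eig/(eigenvalue_adjmx_opp conn_e graph_e bip_e) :
    exists2 j, (j <= D)%N & (theta i)%:C = (theta j)%:C by exists i.
  by move=> /theta_eig[j jD]; rewrite -rmorphN => -[tj]; exists j.
(* With theta_d = 0 the inverse is that of - b_2, and b_2 is nonzero because 2 < D. *)
have local_b3 : has_local_eigenvalue e x W ((b 3)%:R - 1).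
  have b2 : (b 2)%:R != 0 :> R by rewrite pnatr_eq0 -lt0n (b_pos conn_e dreg_e x) //; lia.
  move=> w /local_W->; congr (_ *: _); rewrite theta_mid expr0n sub0r invrN mulrN opprK.
  by rewrite mulrAC mulfV // mul1r rmorphD rmorphN rmorph1 rmorph_nat addrC.
move=> lhs rhs; have lhsE i : lhs i = up_comp e x v i by rewrite /lhs /up_comp addn2.
have lhs_rhs i : (i <= D - 2)%N -> lhs i = rhs i.
  by move=> iD; rewrite lhsE; apply: (upper_eq_sum_ppoly
    conn_e graph_e bip_e dreg_e val_e D_even D_ge4 irr_W).
have lhs0 : lhs (D - 2)%N = 0.
  by rewrite lhsE; apply: (upper_last conn_e graph_e bip_e dreg_e val_e D_even D_ge4 irr_W).
by split=> //; split=> //; rewrite -lhs_rhs.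
Qed.
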